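(* Let $p$ be a prime. Then the equation $$a^2 - ab + b^2 = p$$ has a solution in integers $a,b \in \mathbb{Z}$ if and only if $p = 3$ or $p$ is of the form $6k+1$ for some integer $k$. *)

(* Defs.v *)
From mathcomp Require Export all_boot all_order all_algebra.

(* Main.v *)
(** The values of a^2 - ab + b^2 are 0 or 1 modulo 3, which settles necessity.
    Conversely, if 3 divides p - 1 then F_p contains c with c^2 - c + 1 = 0
    (minus an element of order 3); Thue's pigeonhole argument gives a small
    nonzero pair with a = c b modulo p, so that p divides a^2 - ab + b^2, which
    lies strictly between 0 and 3p.  The value 2p is excluded because it is
    2 modulo 3. *)
Require Import Defs.
From mathcomp Require Import all_boot all_order all_algebra.
From mathcomp Require Import all_fingroup all_solvable all_field.
From mathcomp Require Import zify ring.
Import GRing.Theory.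
Local Open Scope ring_scope.

(** Since -ab and 2ab agree modulo 3, the form is congruent to (a + b)^2, so only the residue [e] of
    a + b matters. *)
Lemma sqr_sub_mul_add_sqr_mod3 (a b : int) :
  exists q : int, a ^+ 2 - a * b + b ^+ 2 = 3 * q \/
                  a ^+ 2 - a * b + b ^+ 2 = 3 * q + 1.
Proof.
have [t [e [def_ab e01]]] : exists t e : int,
    a + b = 3 * t + e /\ (e = 0 \/ e = 1 \/ e = - 1).
  exists ((a + b + 1) %/ 3)%Z, (((a + b + 1) %% 3)%Z - 1); lia.
have -> : a = 3 * t + e - b by lia.
have [->|[->|->]] := e01.
- by exists (3 * t ^+ 2 - 3 * t * b + b ^+ 2); left; ring.
- by exists (3 * t ^+ 2 + 2 * t - 3 * t * b - b + b ^+ 2); right; ring.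
- by exists (3 * t ^+ 2 - 2 * t - 3 * t * b + b + b ^+ 2); right; ring.
Qed.

Lemma sqr_sub_mul_add_sqr_gt0 (a b : int) :
  (a, b) != (0, 0) -> 0 < a ^+ 2 - a * b + b ^+ 2.
Proof.
move=> ab_neq0; have [b0|b_neq0] := eqVneq b 0.
  have a_neq0 : a <> 0 by move=> a0; rewrite a0 b0 eqxx in ab_neq0.
  by rewrite b0; nia.
(* Completing the square: 4(a^2 - ab + b^2) = (2a - b)^2 + 3b^2. *)
have : 0 < b ^+ 2 by nia.
have : 0 <= (2 * a - b) ^+ 2 by nia.
nia.
Qed.

Lemma Fp_root_sqr_sub_add1 (p : nat) :
  prime p -> (3 %| p.-1)%N -> exists c : 'F_p, c ^+ 2 - c + 1 = 0.
Proof.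
move=> p_prime dv3.
have card_units : #|[set: {unit 'F_p}]| = p.-1.
  by rewrite card_finField_unit card_Fp.
have [|u _ ord_u] := @Cauchy _ 3%N [set: {unit 'F_p}]%G isT.
  by rewrite card_units.
have u3 : (val u) ^+ 3 = 1 by rewrite -FinRing.val_unitX -ord_u expg_order.
have u_neq1 : val u != 1.
  apply/negP=> /eqP u1; have u1' : u = 1%g by apply: val_inj.
  by rewrite u1' order1 in ord_u.
exists (- val u).
(* With c = -u the product is (u - 1)(u^2 + u + 1) = u^3 - 1. *)
have /eqP : (val u - 1) * ((- val u) ^+ 2 - - val u + 1) = 0.
  by rewrite -[RHS](subrr (1 : 'F_p)) -[in RHS]u3; ring: u3.
by rewrite mulf_eq0 subr_eq0 (negPf u_neq1) => /eqP.
Qed.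

Lemma thue (p m : nat) (c : 'F_p) :
  prime p -> (p < m.+1 ^ 2)%N ->
  exists a b : int, [/\ (a, b) != (0, 0), `|a| <= m%:Z, `|b| <= m%:Z &
                        a%:~R = c * b%:~R].
Proof.
move=> p_prime lt_p.
(* The (m + 1)^2 pairs outnumber the p residues, so two distinct pairs collide under [f]; their
   coordinatewise difference is the pair sought. *)
pose f (x : 'I_m.+1 * 'I_m.+1) : 'F_p := (x.1 : nat)%:R - c * (x.2 : nat)%:R.
have /injectivePn[[x1 y1] [[x2 y2] neq_xy eq_f]] : ~~ injectiveb f.
  apply/negP=> /injectiveP /leq_card.
  by rewrite card_prod !card_ord mulnn Fp_cast // leqNgt lt_p.
exists ((x1 : nat)%:Z - (x2 : nat)%:Z), ((y1 : nat)%:Z - (y2 : nat)%:Z).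
have := (ltn_ord x1, ltn_ord x2, ltn_ord y1, ltn_ord y2) => -[[[? ?] ?] ?].
split; try lia.
  apply: contraNneq neq_xy => -[ex ey].
  by apply/eqP; congr pair; apply: val_inj => /=; lia.
rewrite !rmorphB /=; apply/eqP; rewrite -subr_eq0; apply/eqP.
move: eq_f; rewrite /f /= => /eqP; rewrite -subr_eq0 => /eqP <-.
by rewrite -!pmulrn; ring.
Qed.

Lemma sqr_sub_mul_add_sqr_prime (p : nat) :
  prime p -> (3 %| p.-1)%N ->
  exists a b : int, a ^+ 2 - a * b + b ^+ 2 = p%:Z.
Proof.
move=> p_prime dv3; have p_gt1 := prime_gt1 p_prime.
have [c c_root] := Fp_root_sqr_sub_add1 p p_prime dv3.
(* [m] is the integer square root of p. The first inequality is strict because m^2 = p would make m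
   a divisor of p, hence 1 or p. *)
have [m [lt_mp lt_pm]] : exists m, (m ^ 2 < p)%N /\ (p < m.+1 ^ 2)%N.
  have exm : exists m, (p < m.+1 ^ 2)%N by exists p; nia.
  case: (ex_minnP exm) => m lt_pm min_m; exists m; split=> //.
  rewrite ltn_neqAle; apply/andP; split.
    by apply: contraTneq p_prime => <-; apply/primeP=> -[? /(_ m (dvdn_exp _ (dvdnn m)))]; nia.
  by case: m min_m {lt_pm} => [|m] min_m; [lia | have := min_m m; lia].
have [a [b [ab_neq0 le_am le_bm eq_acb]]] := thue p m c p_prime lt_pm.
have : (p%:Z %| a ^+ 2 - a * b + b ^+ 2)%Z.
  (* In F_p, substituting a = cb turns the form into b^2 (c^2 - c + 1). *)
  rewrite (dvdz_pcharf (pchar_Fp p_prime)); apply/eqP.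
  rewrite rmorphD rmorphB !rmorphXn rmorphM /= eq_acb.
  by rewrite -[RHS](mulr0 (b%:~R ^+ 2)) -c_root; ring.
case/dvdzP=> q def_q.
have N_gt0 := sqr_sub_mul_add_sqr_gt0 a b ab_neq0.
(* Both |a| and |b| are at most m, so the form is at most 3m^2, and m^2 < p. *)
have N_lt : a ^+ 2 - a * b + b ^+ 2 < 3 * p%:Z by nia.
have [r def_r] := sqr_sub_mul_add_sqr_mod3 a b.
have q12 : q = 1 \/ q = 2 by nia.
exists a, b; rewrite def_q; case: q12 => q_val; first by rewrite q_val mul1r.
by rewrite def_q q_val in def_r; lia.
Qed.

Theorem theorem1p2 (p : nat) (p_prime : prime p) :
  (exists a b : int, a ^+ 2 - a * b + b ^+ 2 = p%:Z) <->
  (p = 3%N \/ exists k : int, p%:Z = 6 * k + 1).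
Proof.
split=> [[a [b def_p]]|[->|[k def_p]]].
- have [q] := sqr_sub_mul_add_sqr_mod3 a b; rewrite def_p.
  (* 2 is neither 3q nor 3q + 1. For odd p = 3q + 1, q is even, which gives 6k + 1. *)
  have [p2|p_odd] := even_prime p_prime; first by lia.
  case=> [p_eq|p_eq].
    left; apply/esym/eqP; rewrite -dvdn_prime2 //; lia.
  by right; exists (p%:Z %/ 6)%Z; lia.
- by exists 1, (- 1).
- by apply: sqr_sub_mul_add_sqr_prime => //; lia.
Qed.
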